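(* For every integer $n\ge 2$ with $n\neq 3$, the achromatic number of the Kneser graph $K(n,2)$ satisfies $\alpha(K(n,2))=\left\lfloor \binom{n+1}{2}/3\right\rfloor$, and $\alpha(K(3,2))=1$.
   Context: For integers $1\le k\le n/2$ (here $k=2$; the case $n=3$ is also allowed, where $K(3,2)$ is the edgeless graph on the three $2$-subsets of $[3]$), the Kneser graph $K(n,k)$ has as vertices all $k$-element subsets of $[n]=\{1,\dots,n\}$, two vertices being adjacent iff the subsets are disjoint. An $l$-coloring of a graph $G$ is a surjective map from $V(G)$ onto $[l]$; it is proper if adjacent vertices receive different colors, and complete if for every pair of distinct colors $i,j$ there is an edge $xy$ with $x$ colored $i$ and $y$ colored $j$. The achromatic number $\alpha(G)$ is the largest $l$ for which $G$ has a proper complete $l$-coloring. *)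

(* Defs.v *)
From mathcomp Require Import all_boot.

Set Implicit Arguments.
Unset Strict Implicit.
Unset Printing Implicit Defensive.

(* A finite simple graph is a finType together with a symmetric irreflexive
   adjacency relation; the set of colors [l] is 'I_l. A coloring must use every
   color but need not be proper. *)
Definition coloring (T : finType) (l : nat) (c : {ffun T -> 'I_l}) : bool :=
  [forall i, exists x, c x == i].

Definition proper_coloring (T : finType) (e : rel T) (l : nat)
    (c : {ffun T -> 'I_l}) : bool :=
  [forall x, forall y, e x y ==> (c x != c y)].

Definition complete_coloring (T : finType) (e : rel T) (l : nat)
    (c : {ffun T -> 'I_l}) : bool :=
  [forall i, forall j, (i != j) ==>
    [exists x, exists y, [&& e x y, c x == i & c y == j]]].

Definition has_proper_complete_coloring (T : finType) (e : rel T) (l : nat) : bool :=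
  [exists c : {ffun T -> 'I_l},
    [&& coloring c, proper_coloring e c & complete_coloring e c]].

(* The range of the maximum is exhaustive: a surjection of T onto [l] forces
   l <= #|T|; see leq_achromatic_number and achromatic_number_attained. *)
Definition achromatic_number (T : finType) (e : rel T) : nat :=
  \max_(l < #|T|.+1 | has_proper_complete_coloring e l) l.

Lemma leq_achromatic_number (T : finType) (e : rel T) (l : nat) :
  has_proper_complete_coloring e l -> l <= achromatic_number e.
Proof.
move=> hl; have lT : l < #|T|.+1.
  case/existsP: hl => c /and3P[/forallP sc _ _].
  rewrite ltnS -[X in X <= _]card_ord.
  have inv i : {x | c x == i} by apply: sigW; apply/existsP.
  apply: (@leq_card _ _ (fun i => sval (inv i))) => i j eqij.
  by rewrite -(eqP (svalP (inv i))) eqij (eqP (svalP (inv j))).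
exact: (@leq_bigmax_cond _ (fun l : 'I_#|T|.+1 =>
  has_proper_complete_coloring e l) (@nat_of_ord _) (Ordinal lT)).
Qed.

Lemma achromatic_number_attained (T : finType) (e : rel T) (l : nat) :
  has_proper_complete_coloring e l ->
  has_proper_complete_coloring e (achromatic_number e).
Proof.
move=> hl; have := leq_achromatic_number hl; rewrite /achromatic_number.
elim/big_ind: _ => [|m1 m2 h1 h2|i //]; first by rewrite leqn0 => /eqP <-.
rewrite /maxn; case: ltnP => [lt12|le21] le_l; first exact: h2.
exact: h1.
Qed.

Definition kneser_vertex (n k : nat) := {A : {set 'I_n} | #|A| == k}.

Definition kneser (n k : nat) : rel (kneser_vertex n k) :=
  fun A B => [disjoint val A & val B].
Arguments kneser : clear implicits.

Lemma kneser_sym (n k : nat) : symmetric (kneser n k).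
Proof. by move=> A B; rewrite /kneser disjoint_sym. Qed.

Lemma kneser_irrefl (n k : nat) : 0 < k -> irreflexive (kneser n k).
Proof.
move=> k_gt0 A; apply/negbTE; rewrite /kneser -setI_eq0 setIid -card_gt0.
by rewrite (eqP (valP A)).
Qed.

(* Main.v *)
(* Upper bound: let each color class of size 1 own the two endpoints of its edge
   and each class of size 2 own the common endpoint of its two edges. By
   completeness no vertex is owned twice, and each class has at least three
   edges and owned vertices in total, so 3l <= C(n,2) + n.

   Lower bound: in a decomposition of the edges of K_n into triangles, pairwise
   disjoint single edges, and two-edge paths with distinct centers off the
   single edges, none of the paths being completed to a triangle by a single edge,
   any two classes contain disjoint edges. It remains to find such decompositions
   where all (or all but at most two) vertices are owned. They come from
   commutative quasigroups via the schemes of Bose and Skolem: for n = 3q+1 from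
   x + y on three copies of a group of order q plus a point; for n = 2 mod 6 and
   n = 0 mod 6 by deleting a point of a Steiner triple system; for n = 3 mod 6
   from a twisted Bose scheme whose leftover edges form long cycles; for
   n = 5 mod 6 from the Bose scheme with two additional points. *)
Require Import Defs.
From mathcomp Require Import all_boot.
From mathcomp Require Import all_algebra zify.

Set Implicit Arguments.
Unset Strict Implicit.
Unset Printing Implicit Defensive.

(** * The upper bound *)

Lemma card_kneser_vertex n k : #|{: kneser_vertex n k}| = 'C(n, k).
Proof. by rewrite card_sig -[n in RHS]card_ord -card_draws cardsE. Qed.

Lemma card_sum_fibers (aT rT : finType) (X : {pred aT}) (f : aT -> rT) :
  #|X| = \sum_k #|[set x in X | f x == k]|.
Proof.
rewrite -sum1_card (partition_big f predT) //=.
by apply: eq_bigr => k _; rewrite -sum1_card; apply: eq_bigl => x; rewrite inE.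
Qed.

Lemma complete_coloring_leq n l :
  has_proper_complete_coloring (kneser n 2) l -> l * 3 <= 'C(n.+1, 2).
Proof.
case/existsP=> c /and3P[/forallP c_surj /forallP c_prop /forallP c_comp].
pose F (k : 'I_l) := [set A : kneser_vertex n 2 | c A == k].
(* Edges of one color pairwise meet, so the intersection consists of both endpoints of a lone edge,
   or of the common endpoint of two edges. Larger classes own nothing. *)
pose L k : {set 'I_n} := if #|F k| <= 2 then \bigcap_(A in F k) val A else set0.
have F_inter k A B : A \in F k -> B \in F k -> val A :&: val B != set0.
  rewrite !inE => /eqP cA /eqP cB; have /forallP/(_ B) := c_prop A.
  by rewrite cA cB eqxx implybF /kneser -setI_eq0.
have wL k : 3 <= #|F k| + #|L k|.
  have : 0 < #|F k|.
    by have /existsP[A cA] := c_surj k; apply/card_gt0P; exists A; rewrite inE.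
  rewrite /L; case: ifP => [F2 F0|/negbT]; last by rewrite -ltnNge cards0; lia.
  have [F1|F1] := eqVneq #|F k| 1.
    have /eqP/cards1P[A ->] := F1.
    by rewrite big_set1 cards1 (eqP (valP A)).
  have /eqP/cards2P[A [B [neAB eqF]]] : #|F k| = 2 by lia.
  rewrite eqF cards2 neAB big_setU1 ?inE // big_set1.
  by rewrite -addn1 leq_add // card_gt0 (F_inter k) // eqF !inE eqxx ?orbT.
(* A vertex owned twice would lie on every edge of both classes, while completeness yields two
   disjoint edges. *)
have disjL k k' : k != k' -> [disjoint L k & L k'].
  move=> neq; apply/pred0P => v /=; apply/negP => /andP[].
  rewrite /L; do 2![case: ifP => _; last by rewrite inE].
  move=> /bigcapP vk /bigcapP vk'.
  have /forallP/(_ k')/implyP/(_ neq) := c_comp k.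
  case/existsP=> A /existsP[B /and3P[dAB cA cB]].
  have vA : v \in val A by apply: vk; rewrite inE.
  have vB : v \in val B by apply: vk'; rewrite inE.
  by have /pred0P/(_ v) := dAB; rewrite /= vA vB.
have sumL : \sum_k #|L k| <= n.
  under eq_bigr do rewrite -sum1_card big_mkcond /=.
  rewrite exchange_big -[X in _ <= X]card_ord -sum1_card /=.
  apply: leq_sum => v _; rewrite -big_mkcond sum1_card.
  apply/card_le1_eqP => k k' vk vk'.
  apply/eqP/negPn/negP => /disjL /pred0P/(_ v)/negP; apply.
  by apply/andP; split; rewrite topredE.
rewrite binS bin1 -card_kneser_vertex (card_sum_fibers _ c) mulnC.
have -> : 3 * l = \sum_(k < l) 3 by rewrite sum_nat_const card_ord mulnC.
apply: leq_trans (leq_add (leqnn _) sumL); rewrite -big_split /=.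
by apply: leq_sum => k _; apply: leq_trans (wL k) _; rewrite leq_add2r.
Qed.

(** Transport along [enum_val]: constructions may use any finite vertex type and any finite type of
    colors, of which only those taken on pairs are counted. *)
Lemma pair_coloring_complete (V K : finType) (col : {set V} -> K) :
    1 < #|V| ->
    (forall A B : {set V}, #|A| = 2 -> #|B| = 2 -> col A = col B ->
      A :&: B != set0) ->
    (forall A B : {set V}, #|A| = 2 -> #|B| = 2 -> col A != col B ->
      exists A' B' : {set V}, [/\ #|A'| = 2, #|B'| = 2, col A' = col A,
        col B' = col B & A' :&: B' = set0]) ->
  has_proper_complete_coloring (kneser #|V| 2)
    #|col @: [set A : {set V} | #|A| == 2]|.
Proof.
move=> V_gt1 col_prop col_comp; set colors := col @: _.
have colorsP (A : {set V}) : #|A| = 2 -> col A \in colors.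
  by move=> A2; apply/imset_f; rewrite inE A2.
have [A0 A0_2] : exists A : {set V}, #|A| = 2.
  have: 0 < #|[set A : {set V} | #|A| == 2]| by rewrite card_draws bin_gt0.
  by case/card_gt0P => A; rewrite inE => /eqP; exists A.
pose pull (A : kneser_vertex #|V| 2) : {set V} := enum_val @: val A.
have pull2 A : #|pull A| = 2.
  by rewrite card_imset ?(eqP (valP A)) //; apply: enum_val_inj.
have pullK (B : {set V}) : #|B| = 2 -> exists A, pull A = B.
  move=> B2; have rB2 : #|enum_rank @: B| == 2.
    by rewrite card_imset ?B2 //; apply: enum_rank_inj.
  exists (Sub (enum_rank @: B) rB2); rewrite /pull /= -imset_comp.
  by rewrite -[RHS]imset_id; apply: eq_imset => x /=; rewrite enum_rankK.
have pullI A B : (pull A :&: pull B == set0) = kneser #|V| 2 A B.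
  rewrite -imsetI; last by move=> x y _ _; apply: enum_val_inj.
  by rewrite imset_eq0 setI_eq0.
(* [A0] supplies the inhabitant of [colors] that [enum_rank_in] asks for. *)
pose c := [ffun A => enum_rank_in (colorsP A0 A0_2) (col (pull A))].
have cE A : enum_val (c A) = col (pull A).
  by rewrite ffunE enum_rankK_in // colorsP.
apply/existsP; exists c; apply/and3P; split.
- apply/forallP => i; have /imsetP[B] := enum_valP i.
  rewrite inE => /eqP /pullK[A <-] eqi; apply/existsP; exists A.
  by apply/eqP/enum_val_inj; rewrite cE eqi.
- apply/forallP => A; apply/forallP => B; apply/implyP; rewrite -pullI.
  by apply: contraL => /eqP eqc; apply: col_prop; rewrite -?cE ?eqc.
apply/forallP => i; apply/forallP => j; apply/implyP => neij.
have /imsetP[A + eqi] := enum_valP i; have /imsetP[B + eqj] := enum_valP j.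
rewrite !inE => /eqP B2 /eqP A2.
have [|A' [B' [A'2 B'2 eqA eqB]]] := col_comp A B A2 B2.
  by rewrite -eqi -eqj (inj_eq enum_val_inj).
have [[A1 defA] [B1 defB]] := (pullK _ A'2, pullK _ B'2).
rewrite -defA -defB in eqA eqB * => /eqP; rewrite pullI => dAB.
apply/existsP; exists A1; apply/existsP; exists B1; rewrite dAB /=.
by apply/andP; split; apply/eqP/enum_val_inj; rewrite cE ?eqA ?eqB -?eqi -?eqj.
Qed.

(** * Decompositions into triangles, single edges and paths *)

Lemma set2_inj (T : finType) (x y u v : T) :
  [set x; y] = [set u; v] -> (x = u /\ y = v) \/ (x = v /\ y = u).
Proof.
move=> eqA.
have /set2P xuv : x \in [set u; v] by rewrite -eqA set21.
have /set2P yuv : y \in [set u; v] by rewrite -eqA set22.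
have /set2P uxy : u \in [set x; y] by rewrite eqA set21.
have /set2P vxy : v \in [set x; y] by rewrite eqA set22.
by intuition congruence.
Qed.

(* [h] encodes a decomposition of the edges of the complete graph on [V] into
   color classes: [h x y] is [None] if {x, y} is a class by itself, [Some x]
   (resp. [Some y]) if it belongs to the two-edge path centered at x (resp. y),
   and [Some z] with z distinct from x and y if the class is the triangle xyz.
   [D] is a set of vertices lying on a single edge or centering a path. *)
Record complete_system (V : finType) (D : {set V}) (h : V -> V -> option V) :
    Prop := CompleteSystem {
  systemC : forall x y, h x y = h y x;
  system_triangle : forall x y z, x != y -> z != x -> z != y ->
    h x y = Some z -> h x z = Some y;
  system_single : forall x y z, x != y -> x != z ->
    h x y = None -> h x z = None -> y = z;
  system_single_star : forall x y z, x != y -> x != z ->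
    h x y = None -> h x z <> Some x;
  system_star : forall x y, x != y -> h x y = Some x ->
    exists z, [/\ x != z, y != z, h x z = Some x, h y z <> None &
      forall w, x != w -> h x w = Some x -> w = y \/ w = z];
  system_cover : forall x, x \in D ->
    exists2 y, x != y & h x y = None \/ h x y = Some x }.

(* A class is named by its triangle, by its edge, or by its center. The diagonal
   value is the class charged with the loop at x in the count of loops below. *)
Definition pair_color (V : finType) (h : V -> V -> option V) (x y : V) :
    {set V} :=
  if x == y then
    if [pick z | (x != z) && (h x z == None)] is Some z
    then [set x; z] else [set x]
  else if h x y is Some z then
    if (z == x) || (z == y) then [set z] else [set x; y; z]
  else [set x; y].

Variant pair_spec (V : finType) (h : V -> V -> option V) (x y : V) :
    {set V} -> Prop :=
| PairTriangle z of z != x & z != y & h x y = Some z & h x z = Some y &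
    h y z = Some x : pair_spec h x y [set x; y; z]
| PairSingle of h x y = None : pair_spec h x y [set x; y]
| PairStarL of h x y = Some x : pair_spec h x y [set x]
| PairStarR of h x y = Some y : pair_spec h x y [set y].

Lemma pair_colorP (V : finType) (D : {set V}) (h : V -> V -> option V) x y :
  complete_system D h -> x != y -> pair_spec h x y (pair_color h x y).
Proof.
move=> sys nexy; rewrite /pair_color (negPf nexy).
case hxy: (h x y) => [z|]; last exact: PairSingle.
have [eqzx|nezx] /= := eqVneq z x.
  by rewrite eqzx; apply: PairStarL; rewrite hxy eqzx.
have [eqzy|nezy] := eqVneq z y.
  by rewrite eqzy; apply: PairStarR; rewrite hxy eqzy.
apply: PairTriangle => //; first exact: (system_triangle sys) hxy.
by apply: (system_triangle sys) nezy nezx _; rewrite 1?eq_sym // (systemC sys).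
Qed.

Lemma pair_colorC (V : finType) (D : {set V}) (h : V -> V -> option V) x y :
  complete_system D h -> pair_color h x y = pair_color h y x.
Proof.
move=> sys; have [-> //|nexy] := eqVneq x y.
rewrite /pair_color (negPf nexy) eq_sym (negPf nexy) (systemC sys) setUC.
by case: (h y x) => // z; rewrite orbC.
Qed.

(** The two components of the picked pair may coincide, so that a singleton stands for the loop at
    its point. *)
Definition set_color (V : finType) (h : V -> V -> option V) (A : {set V}) :
    {set V} :=
  if [pick p : V * V | A == [set p.1; p.2]] is Some p
  then pair_color h p.1 p.2 else set0.

Lemma set_color2 (V : finType) (D : {set V}) (h : V -> V -> option V) x y :
  complete_system D h -> set_color h [set x; y] = pair_color h x y.
Proof.
move=> sys; rewrite /set_color; case: pickP => [p /eqP|/(_ (x, y))/eqP//].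
by case/set2_inj => -[-> ->] //; apply: pair_colorC sys.
Qed.

(** The name of a class either contains the edge and has at most three points, or is a center lying
    on the edge. Two edges sharing a name must therefore meet. *)
Lemma system_proper (V : finType) (D : {set V}) (h : V -> V -> option V)
    (x y u v : V) :
  complete_system D h -> x != y -> u != v ->
  pair_color h x y = pair_color h u v -> [set x; y] :&: [set u; v] != set0.
Proof.
move=> sys nexy neuv eqc; apply/set0Pn.
suff: [|| x == u, x == v, y == u | y == v].
  by case/or4P => /eqP e; [exists x|exists x|exists y|exists y];
    rewrite !inE !e !eqxx ?orbT.
have /setP eqS := eqc; move: (eqS u) (eqS v) (eqS x) (eqS y).
case: (pair_colorP sys nexy) => [z nzx nzy _ _ _|_|_|_];
  case: (pair_colorP sys neuv) => [w nwu nwv _ _ _|_|_|_];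
  rewrite !inE !eqxx ?orbT /= ?[u == x]eq_sym ?[u == y]eq_sym
    ?[v == x]eq_sym ?[v == y]eq_sym.
all: try by case: (x == u) (x == v) (y == u) (y == v) => [] [] [] [].
all: case: (x == u) => //=; case: (x == v) => //=.
all: case: (y == u) => //=; case: (y == v) => //=.
(* What remains is u and v both equal to the third point z of the triangle. *)
all: by move=> /eqP uz /eqP vz; rewrite uz vz eqxx in neuv.
Qed.

Lemma disjoint_set2 (T : finType) (a b c d : T) :
  ([set a; b] :&: [set c; d] == set0) = [&& a != c, a != d, b != c & b != d].
Proof.
rewrite setI_eq0 disjoints_subset subUset !sub1set !inE !negb_or.
by rewrite -andbA.
Qed.

(** An edge of another class is not a side, so it has at most one vertex on the triangle; the side
    opposite that vertex avoids it. *)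
Lemma triangle_avoids (V : finType) (D : {set V}) (h : V -> V -> option V)
    (x y z u v : V) :
    complete_system D h -> x != y -> z != x -> z != y -> h x y = Some z ->
    u != v -> pair_color h x y != pair_color h u v ->
  exists a b, [/\ a != b, pair_color h a b = pair_color h x y &
    [set a; b] :&: [set u; v] = set0].
Proof.
move=> sys nxy nzx nzy hxy nuv nec.
have hxz : h x z = Some y := system_triangle sys nxy nzx nzy hxy.
have hyz : h y z = Some x.
  by apply: (system_triangle sys) nzy nzx _; rewrite 1?eq_sym // (systemC sys).
have cxy : pair_color h x y = [set x; y; z].
  by rewrite /pair_color (negPf nxy) hxy (negPf nzx) (negPf nzy).
have cxz : pair_color h x z = [set x; y; z].
  rewrite /pair_color eq_sym (negPf nzx) hxz eq_sym (negPf nxy) eq_sym.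
  by rewrite (negPf nzy) setUAC.
have cyz : pair_color h y z = [set x; y; z].
  rewrite /pair_color eq_sym (negPf nzy) hyz (negPf nxy) eq_sym (negPf nzx).
  by rewrite setUC setUA.
have out2 a b : pair_color h a b = [set x; y; z] ->
    [set u; v] = [set a; b] -> False.
  move=> cab /set2_inj[] [eu ev]; rewrite {}eu {}ev in nec.
    by rewrite cxy cab eqxx in nec.
  by rewrite cxy (pair_colorC _ _ sys) cab eqxx in nec.
suff [a [b [nab cab /eqP dab]]] : exists a b, [/\ a != b,
    pair_color h a b = [set x; y; z] & [set a; b] :&: [set u; v] == set0].
  by exists a, b; rewrite cxy.
have [xuv|] := boolP (x \in [set u; v]).
  exists y, z; rewrite eq_sym disjoint_set2; split=> //.
  case/set2P: xuv => ex; rewrite -ex in nuv out2 *.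
    rewrite [y == x]eq_sym nxy nzx /=; apply/andP; split.
      by apply/eqP => e; apply: (out2 x y); rewrite // e.
    by apply/eqP => e; apply: (out2 x z); rewrite // e.
  rewrite [y == x]eq_sym nxy nzx !andbT; apply/andP; split.
    by apply/eqP => e; apply: (out2 x y); rewrite // e setUC.
  by apply/eqP => e; apply: (out2 x z); rewrite // e setUC.
rewrite !inE negb_or => /andP[xu xv].
have [yuv|] := boolP (y \in [set u; v]).
  exists x, z; rewrite eq_sym disjoint_set2 xu xv; split=> //=.
  case/set2P: yuv => ey; rewrite -ey in nuv out2 *; rewrite nzy ?andbT /=.
    by apply/eqP => e; apply: (out2 y z); rewrite // e.
  by apply/eqP => e; apply: (out2 y z); rewrite // e setUC.
rewrite !inE negb_or => /andP[yu yv].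
by exists x, y; rewrite disjoint_set2 xu xv yu yv.
Qed.

Lemma star_edges (V : finType) (D : {set V}) (h : V -> V -> option V)
    (x y : V) :
    complete_system D h -> x != y ->
    h x y = Some x \/ h x y = Some y ->
  exists c a b, [/\ [/\ c != a, c != b & a != b], h c a = Some c,
    h c b = Some c, h a b <> None & pair_color h x y = [set c]].
Proof.
move=> sys nxy; wlog hxy : x y nxy / h x y = Some x => [th [hx|hy]|_].
- by apply: th => //; left.
- rewrite (pair_colorC _ _ sys); apply: th; rewrite 1?eq_sym //.
    by rewrite (systemC sys).
  by left; rewrite (systemC sys).
have [z [nxz nyz hxz hyz _]] := system_star sys nxy hxy.
exists x, y, z; split=> //.
by rewrite /pair_color (negPf nxy) hxy eqxx.
Qed.

Lemma star_color (V : finType) (h : V -> V -> option V) (x y : V) :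
  x != y -> h x y = Some x -> pair_color h x y = [set x].
Proof. by move=> nxy hxy; rewrite /pair_color (negPf nxy) hxy eqxx. Qed.

Lemma single_color (V : finType) (h : V -> V -> option V) (x y : V) :
  x != y -> h x y = None -> pair_color h x y = [set x; y].
Proof. by move=> nxy hxy; rewrite /pair_color (negPf nxy) hxy. Qed.

Definition has_disjoint_pairs (V : finType) (h : V -> V -> option V)
    (S S' : {set V}) :=
  exists a b c d, [/\ a != b, c != d, pair_color h a b = S,
    pair_color h c d = S' & [set a; b] :&: [set c; d] = set0].

Lemma has_disjoint_pairsC (V : finType) (h : V -> V -> option V) S S' :
  has_disjoint_pairs h S S' -> has_disjoint_pairs h S' S.
Proof. by case=> a [b [c [d []]]]; exists c, d, a, b; rewrite setIC. Qed.

(** The center is off the single edge by [system_single_star]. Both leaves cannot lie on it, since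
    the leaves of a path are not joined by a single edge; the arm to a leaf off it is disjoint from
    it. *)
Lemma single_star_disjoint (V : finType) (D : {set V})
    (h : V -> V -> option V) (x y u v : V) :
    complete_system D h -> x != y -> u != v -> h x y = None ->
    h u v = Some u \/ h u v = Some v ->
  has_disjoint_pairs h (pair_color h x y) (pair_color h u v).
Proof.
move=> sys nxy nuv hxy /(star_edges sys nuv).
move=> [c [a [b [[nca ncb nab] hca hcb hab ->]]]].
have nyx : y != x by rewrite eq_sym.
have hyx : h y x = None by rewrite (systemC sys).
have ncx : c != x.
  apply/eqP => e; rewrite e in nca hca.
  exact: (system_single_star sys nxy nca hxy hca).
have ncy : c != y.
  apply/eqP => e; rewrite e in nca hca.
  exact: (system_single_star sys nyx nca hyx hca).
have [axy|] := boolP (a \in [set x; y]).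
  exists x, y, c, b; rewrite (@star_color _ _ c b) //; split=> //; apply/eqP.
  rewrite disjoint_set2 eq_sym ncx [y == c]eq_sym ncy /= andbC.
  case/set2P: axy => ea; rewrite ea in nab hab.
    rewrite nab andbT; apply/eqP => e; apply: hab; by rewrite -e.
  rewrite nab /=; apply/eqP => e; apply: hab; by rewrite -e (systemC sys).
rewrite !inE negb_or => /andP[nax nay].
exists x, y, c, a; rewrite (@star_color _ _ c a) //; split=> //; apply/eqP.
by rewrite disjoint_set2 ![_ == c]eq_sym ncx ncy ![_ == a]eq_sym nax nay.
Qed.

(** The edge joining the two centers belongs to at most one of the paths. Hence one path keeps both
    arms and the other at least one, which leaves room to choose distinct leaves. *)
Lemma star_star_disjoint (V : finType) (D : {set V})
    (h : V -> V -> option V) (x y u v : V) :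
    complete_system D h -> x != y -> u != v ->
    h x y = Some x \/ h x y = Some y -> h u v = Some u \/ h u v = Some v ->
    pair_color h x y != pair_color h u v ->
  has_disjoint_pairs h (pair_color h x y) (pair_color h u v).
Proof.
move=> sys nxy nuv.
move=> /(star_edges sys nxy)[c [a [b [[nca ncb nab] hca hcb _ ->]]]].
move=> /(star_edges sys nuv)[w [p [q [[nwp nwq npq] hwp hwq _ ->]]]].
rewrite (inj_eq set1_inj) => ncw.
have ww s t : h c s = Some c -> h w t = Some w -> s = w -> t = c -> False.
  move=> e1 e2 es et; rewrite es (systemC sys) -et e2 in e1.
  by case: e1 => e; rewrite e et eqxx in ncw.
have pick s t : c != s -> w != t -> h c s = Some c -> h w t = Some w ->
    s != w -> t != c -> s != t -> has_disjoint_pairs h [set c] [set w].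
  move=> ncs nwt hcs hwt nsw ntc nst; exists c, s, w, t; rewrite !star_color //.
  by split=> //; apply/eqP; rewrite disjoint_set2 ncw eq_sym ntc nsw nst.
have [eaw|naw] := eqVneq a w.
  have nbw : b != w by rewrite -eaw eq_sym.
  have npc : p != c by apply/eqP; apply: ww hca hwp eaw.
  have nqc : q != c by apply/eqP; apply: ww hca hwq eaw.
  have [ebp|nbp] := eqVneq b p; last exact: (pick b p).
  by apply: (pick b q); rewrite // ebp.
have [ebw|nbw] := eqVneq b w.
  have npc : p != c by apply/eqP; apply: ww hcb hwp ebw.
  have nqc : q != c by apply/eqP; apply: ww hcb hwq ebw.
  have [eap|nap] := eqVneq a p; last exact: (pick a p).
  by apply: (pick a q); rewrite // eap.
have [epc|npc] := eqVneq p c.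
  have nqc : q != c by rewrite -epc eq_sym.
  have [eaq|naq] := eqVneq a q; last exact: (pick a q).
  by apply: (pick b q); rewrite // -eaq eq_sym.
have [eap|nap] := eqVneq a p; last exact: (pick a p).
by apply: (pick b p); rewrite // -eap eq_sym.
Qed.

Lemma system_disjoint (V : finType) (D : {set V}) (h : V -> V -> option V)
    (x y u v : V) :
  complete_system D h -> x != y -> u != v ->
  pair_color h x y != pair_color h u v ->
  has_disjoint_pairs h (pair_color h x y) (pair_color h u v).
Proof.
move=> sys nxy nuv nec.
have kind s t : s != t -> [\/ exists2 z, z != s & z != t /\ h s t = Some z,
    h s t = None | h s t = Some s \/ h s t = Some t].
  move=> nst; case: (pair_colorP sys nst) => [z nzs nzt hst _ _|hst|hst|hst].
  - by apply: Or31; exists z.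
  - exact: Or32.
  - by apply: Or33; left.
  by apply: Or33; right.
have [[z nzx [nzy hxy]]|hxy|hxy] := kind x y nxy.
- have [a [b [nab cab dab]]] := triangle_avoids sys nxy nzx nzy hxy nuv nec.
  by exists a, b, u, v.
- have [[z nzu [nzv huv]]|huv|huv] := kind u v nuv.
  + rewrite eq_sym in nec.
    have [a [b [nab cab dab]]] := triangle_avoids sys nuv nzu nzv huv nxy nec.
    by exists x, y, a, b; rewrite setIC.
  (* Two single edges through a common point p coincide by [system_single]; [mate] rewrites each as
     an edge starting at p. *)
  + have mate s t p : s != t -> h s t = None -> p \in [set s; t] ->
        exists q, [/\ p != q, h p q = None & [set s; t] = [set p; q]].
      move=> nst hst /set2P[] ->; [by exists t|exists s].
      by rewrite eq_sym (systemC sys) setUC.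
    exists x, y, u, v; split=> //; apply/setP => p; rewrite !in_set0 in_setI.
    apply/negP => /andP[/(mate _ _ _ nxy hxy)[q [npq hpq exy]]].
    move=> /(mate _ _ _ nuv huv)[q' [npq' hpq' euv]].
    move: nec; rewrite (single_color nxy hxy) (single_color nuv huv) exy euv.
    by rewrite (system_single sys npq npq' hpq hpq') eqxx.
  exact: (single_star_disjoint sys).
have [[z nzu [nzv huv]]|huv|huv] := kind u v nuv.
- rewrite eq_sym in nec.
  have [a [b [nab cab dab]]] := triangle_avoids sys nuv nzu nzv huv nxy nec.
  by exists x, y, a, b; rewrite setIC.
- by apply/has_disjoint_pairsC/(single_star_disjoint sys).
exact: (star_star_disjoint sys).
Qed.

(** * Counting the classes *)

Variant loop_spec (V : finType) (h : V -> V -> option V) (x : V) :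
    {set V} -> Prop :=
| LoopSingle y of x != y & h x y = None : loop_spec h x [set x; y]
| LoopStar of (forall y, x != y -> h x y <> None) : loop_spec h x [set x].

Lemma pair_color_loopP (V : finType) (h : V -> V -> option V) x :
  loop_spec h x (pair_color h x x).
Proof.
rewrite /pair_color eqxx; case: pickP => [y /andP[nxy /eqP hxy]|none].
  exact: LoopSingle.
by apply: LoopStar => y nxy hxy; have := none y; rewrite nxy hxy eqxx.
Qed.

Lemma card_set3_leq (T : finType) (a b c : T) : #|[set a; b; c]| <= 3.
Proof. by rewrite setUC cardsU1 cards2; case: (_ \notin _); case: (_ != _). Qed.

(** Triangles, single edges and paths have names of three, two and one points, so the kinds do not
    mix. A triangle has three sides and no loop, an edge at most the loops at its endpoints, a path
    two edges and at most the loop at its center. *)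
Lemma system_fiber (V : finType) (D : {set V}) (h : V -> V -> option V)
    (x y : V) :
    complete_system D h -> x != y ->
  #|[set A : {set V} | (0 < #|A| <= 2) && (set_color h A == pair_color h x y)]|
    <= 3.
Proof.
move=> sys nxy; set S := pair_color h x y.
have fibP (A : {set V}) : 0 < #|A| <= 2 -> set_color h A = S ->
    (exists2 u, A = [set u] & pair_color h u u = S) \/
    (exists u v, [/\ A = [set u; v], u != v & pair_color h u v = S]).
  move=> A12; have [/cards1P[u ->]|nA1] := boolP (#|A| == 1).
    rewrite -[[set u]]setUid (set_color2 _ _ sys); left.
    by exists u; rewrite ?setUid.
  have /cards2P[u [v [nuv ->]]] : #|A| == 2 by lia.
  by rewrite (set_color2 _ _ sys); right; exists u, v.
have bound (B : {set {set V}}) : (forall A : {set V}, 0 < #|A| <= 2 ->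
    set_color h A = S -> A \in B) -> #|B| <= 3 ->
    #|[set A : {set V} | (0 < #|A| <= 2) && (set_color h A == S)]| <= 3.
  move=> sAB; apply: leq_trans; apply: subset_leq_card; apply/subsetP => A.
  by rewrite inE => /andP[A12 /eqP /(sAB _ A12)].
have card2 (u v : V) : u != v -> #|[set u; v]| = 2.
  by move=> n; rewrite cards2 n.
have triC u v w : u != v -> w != u -> w != v -> #|[set u; v; w]| = 3.
  by move=> n1 n2 n3; rewrite setUC cardsU1 cards2 n1 !inE negb_or n2 n3.
have starcase c d : c != d -> h c d = Some c -> S = [set c] ->
    #|[set A : {set V} | (0 < #|A| <= 2) && (set_color h A == S)]| <= 3.
  move=> ncd hcd eS; have [e [nce nde hce _ only]] := system_star sys ncd hcd.
  apply: (bound [set [set c]; [set c; d]; [set c; e]]).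
    2: exact: card_set3_leq.
  have edge u v : u != v -> h u v = Some u -> [set u] = S ->
      [set u; v] \in [set [set c]; [set c; d]; [set c; e]].
    move=> nuv huv; rewrite eS => /set1_inj euc; rewrite euc in nuv huv *.
    by case: (only v nuv huv) => ->; rewrite !inE eqxx ?orbT.
  have S1 : #|S| = 1 by rewrite eS cards1.
  move=> A A12 /(fibP _ A12)[[u -> cu]|[u [v [-> nuv cuv]]]].
    case: (pair_color_loopP h u) cu S1 => [w nuw _ <-|_ cu _].
      by rewrite card2.
    by rewrite cu eS !inE eqxx.
  case: (pair_colorP sys nuv) cuv S1 =>
    [w nwu nwv _ _ _ <-|_ <-|huv eu _|huv ev _].
  - by rewrite triC.
  - by rewrite card2.
  - exact: edge eu.
  by rewrite setUC; apply: edge ev; rewrite 1?eq_sym // (systemC sys).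
have: S = pair_color h x y by [].
case: (pair_colorP sys nxy) => [z nzx nzy _ _ _|hxy|hxy|hxy] eS.
- apply: (bound [set A : {set V} | A \subset S & #|A| == 2]); last first.
    by rewrite cards_draws eS triC.
  have S3 : #|S| = 3 by rewrite eS triC.
  move=> A A12 /(fibP _ A12)[[u -> cu]|[u [v [-> nuv cuv]]]].
    by case: (pair_color_loopP h u) cu S3 => [w nuw _|_] <-;
      rewrite ?card2 ?cards1.
  rewrite inE card2 // eqxx andbT.
  case: (pair_colorP sys nuv) cuv S3 => [w nwu nwv _ _ _|_|_|_] <-.
  + by rewrite subsetUl.
  + by rewrite card2.
  + by rewrite cards1.
  by rewrite cards1.
- have S2 : #|S| = 2 by rewrite eS card2.
  apply: (bound [set S; [set x]; [set y]]); last exact: card_set3_leq.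
  move=> A A12 /(fibP _ A12)[[u -> cu]|[u [v [-> nuv cuv]]]].
    case: (pair_color_loopP h u) cu S2 => [w nuw _ cu _|_ <-].
      2: by rewrite cards1.
    have : u \in S by rewrite -cu set21.
    by rewrite eS => /set2P[]->; rewrite !inE eqxx ?orbT.
  case: (pair_colorP sys nuv) cuv S2 => [w nwu nwv _ _ _|_|_|_] <-.
  + by rewrite triC.
  + by rewrite !inE eqxx.
  + by rewrite cards1.
  by rewrite cards1.
- exact: (starcase x y).
by apply: (starcase y x); rewrite 1?eq_sym // (systemC sys).
Qed.

(* Charging the loop at each vertex of [D] to its edge or path, every class has
   at most three elements. *)
Lemma system_count (V : finType) (D : {set V}) (h : V -> V -> option V) :
    complete_system D h ->
  'C(#|V|, 2) + #|D| <=
    #|set_color h @: [set A : {set V} | #|A| == 2]| * 3.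
Proof.
move=> sys; set P2 := [set A : {set V} | _]; set C := _ @: P2.
pose X := P2 :|: set1 @: D.
have <- : #|X| = 'C(#|V|, 2) + #|D|.
  rewrite cardsU -card_draws (card_imset _ set1_inj).
  suff -> : P2 :&: set1 @: D = set0 by rewrite cards0 subn0.
  apply/setP => A; rewrite !inE; apply/negP => /andP[+ /imsetP[x _ eA]].
  by rewrite eA cards1.
rewrite (card_sum_fibers _ (set_color h)) -sum_nat_const.
rewrite [X in _ <= X]big_mkcond.
apply: leq_sum => S _; case: ifP => [/imsetP[A]|SC].
  rewrite inE => /cards2P[x [y [nxy ->]]]; rewrite (set_color2 _ _ sys) => ->.
  apply: leq_trans (system_fiber sys nxy); apply/subset_leq_card/subsetP => B.
  rewrite !inE => /andP[+ ->]; rewrite andbT.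
  by case/orP=> [/eqP->//|/imsetP[z _ ->]]; rewrite cards1.
rewrite leqn0 cards_eq0; apply/eqP/setP => A; rewrite !inE.
apply/negP => /andP[AX /eqP eqS]; move: SC; rewrite -eqS => /negP; apply.
case/orP: AX => [A2|/imsetP[x xD ->]]; first by apply: imset_f; rewrite inE.
have -> : set_color h [set x] = pair_color h x x.
  by rewrite -{1}[[set x]]setUid (set_color2 _ _ sys).
have colC u v : u != v -> pair_color h u v \in C.
  move=> nuv; rewrite -(set_color2 _ _ sys); apply: imset_f.
  by rewrite inE cards2 nuv.
(* The loop takes the color of the single edge at x or, failing that, of the path that
   [system_cover] centers at x; either is the color of a pair. *)
case: (pair_color_loopP h x) => [y nxy hxy|nosingle].
  by rewrite -(single_color nxy hxy) colC.
have [y nxy [/(nosingle _ nxy)//|hxy]] := system_cover sys xD.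
by rewrite -(star_color nxy hxy) colC.
Qed.

(* A slack of two is harmless: it is absorbed by the floor. *)
Lemma achromatic_number_kneser (V : finType) (D : {set V})
    (h : V -> V -> option V) :
    1 < #|V| -> #|V| <= #|D| + 2 -> complete_system D h ->
  achromatic_number (kneser #|V| 2) = 'C(#|V|.+1, 2) %/ 3.
Proof.
move=> V_gt1 D_big sys.
have has : has_proper_complete_coloring (kneser #|V| 2)
    #|set_color h @: [set A : {set V} | #|A| == 2]|.
  apply: pair_coloring_complete => // A B /eqP/cards2P[x [y [nxy ->]]]
    /eqP/cards2P[u [v [nuv ->]]].
    by rewrite !(set_color2 _ _ sys); apply: system_proper sys nxy nuv.
  rewrite !(set_color2 _ _ sys) => /(system_disjoint sys nxy nuv).
  case=> a [b [c [d [nab ncd cab ccd dis]]]].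
  exists [set a; b], [set c; d].
  by rewrite !(set_color2 _ _ sys) !cards2 nab ncd.
have := leq_achromatic_number has.
have := complete_coloring_leq (achromatic_number_attained has).
have := system_count sys; rewrite binS bin1; lia.
Qed.

(** * Totally symmetric quasigroups *)

(* A totally symmetric quasigroup is an edge decomposition into the triangles
   {x, y, t x y} and the leftover edges {x, t x x}. *)
Record ts_quasigroup (T : eqType) (t : T -> T -> T) : Prop := TsQuasigroup {
  tsC : forall x y, t x y = t y x;
  tsK : forall x y, t x (t x y) = y }.

Lemma tsKK (T : eqType) (t : T -> T -> T) x y :
  ts_quasigroup t -> (t x y == x) = (y == t x x).
Proof.
move=> ts; apply/eqP/eqP => [e|->]; last exact: tsK.
by rewrite -{2}e tsK.
Qed.

Lemma tsKKr (T : eqType) (t : T -> T -> T) x y :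
  ts_quasigroup t -> (t x y == y) = (x == t y y).
Proof. by move=> ts; rewrite (tsC ts) tsKK. Qed.

(** The edge from x to the new point [None] joins the leftover edge from x to [t x x] in a path
    centered at x. There are no single edges, and [None] is the one vertex outside [D]. *)
Lemma achromatic_ts_option (T : finType) (t : T -> T -> T) :
    ts_quasigroup t -> (forall x, t x x != x) -> 0 < #|T| ->
  achromatic_number (kneser #|T|.+1 2) = 'C(#|T|.+2, 2) %/ 3.
Proof.
move=> ts noid T_gt0; rewrite -card_option.
pose h (p q : option T) : option (option T) := match p, q with
  | Some x, Some y => Some (Some (t x y))
  | Some x, None | None, Some x => Some (Some x)
  | None, None => None
  end.
apply: (@achromatic_number_kneser _ [set~ None] h).
- by rewrite card_option ltnS.
- by rewrite cardsC1 card_option; lia.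
split.
- by move=> [x|] [y|] //=; rewrite (tsC ts).
- move=> [x|] [y|] z // _ nzx nzy [ez]; rewrite -ez ?eqxx // in nzx nzy *.
  by rewrite /= (tsK ts).
- by move=> [x|] [y|] [z|].
- by move=> [x|] [y|] [z|].
- move=> [x|] [y|] // nxy => [[/eqP]|_].
    rewrite (tsKK _ _ ts) => /eqP ->; exists None; split=> // -[w|] _.
      by case=> /eqP; rewrite (tsKK _ _ ts) => /eqP ->; left.
    by right.
  exists (Some (t x x)); split=> //=.
  + by apply: contraNneq (noid x) => -[<-].
  + by rewrite (tsK ts).
  move=> [w|] _; last by left.
  by case=> /eqP; rewrite (tsKK _ _ ts) => /eqP ->; right.
by case=> [x|]; rewrite !inE // => _; exists None => //; right.
Qed.

(** An idempotent [t] is a Steiner triple system. Deleting [o] turns the blocks through it into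
    single edges matching all other points; [insub] gives [None] exactly when the third point is
    [o]. *)
Lemma achromatic_ts_point (T : finType) (t : T -> T -> T) (o : T) :
    ts_quasigroup t -> (forall x, t x x = x) -> 2 < #|T| ->
  achromatic_number (kneser #|T|.-1 2) = 'C(#|T|, 2) %/ 3.
Proof.
move=> ts idt T_gt2.
pose V : finType := {x : T | x != o}.
have cardV : #|T|.-1 = #|V| by rewrite card_sig -(cardC1 o).
have -> : #|T| = #|V|.+1 by lia.
rewrite -pred_Sn; pose h (x y : V) : option V := insub (t (val x) (val y)).
have hE x y z : h x y = Some z -> t (val x) (val y) = val z.
  by rewrite /h; case: insubP => // u _ <- [->].
have hN x y : h x y = None -> val y = t (val x) o.
  rewrite /h; case: insubP => [//|/negPn/eqP e _].
  by rewrite -[LHS](tsK ts (val x)) e.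
have hS x y : h x y = Some x -> x = y.
  by move/hE/eqP; rewrite (tsKK _ _ ts) idt => /eqP/val_inj.
apply: (@achromatic_number_kneser _ setT h).
- lia.
- by rewrite cardsT; lia.
split.
- by move=> x y; rewrite /h (tsC ts).
- by move=> x y z nxy nzx nzy /hE e; rewrite /h -e (tsK ts) valK.
- by move=> x y z _ _ /hN ey /hN ez; apply: val_inj; rewrite ey ez.
- by move=> x y z _ nxz _ /hS e; rewrite e eqxx in nxz.
- by move=> x y nxy /hS e; rewrite e eqxx in nxy.
move=> x _; have no : t (val x) o != o.
  by rewrite (tsKKr _ _ ts) idt (valP x).
exists (Sub (t (val x) o) no).
  by rewrite -val_eqE /= eq_sym (tsKK _ _ ts) idt eq_sym (valP x).
by left; rewrite /h /= (tsK ts) insubF // eqxx.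
Qed.

(** * Reassigning the leftover edges *)

Section Override.

Variables (T : finType) (t : T -> T -> T).
Hypothesis ts : ts_quasigroup t.
Let d x := t x x.
Hypothesis noid : forall x, d x != x.

(* Off the diagonal, [src x] replaces the value of [t] on the leftover edge
   between x and [d x]. *)
Definition ts_override (R : Type) (src inj : T -> R) (x y : T) : R :=
  if t x y == x then src x else if t x y == y then src y else inj (t x y).

Lemma ts_overrideL R (src inj : T -> R) x :
  ts_override src inj x (d x) = src x.
Proof. by rewrite /ts_override (tsK ts) eqxx. Qed.

Lemma ts_overrideR R (src inj : T -> R) x :
  ts_override src inj (d x) x = src x.
Proof.
by rewrite /ts_override (tsC ts) (tsK ts) eq_sym (negPf (noid x)) eqxx.
Qed.

Lemma ts_overrideN R (src inj : T -> R) x y :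
  y != d x -> x != d y -> ts_override src inj x y = inj (t x y).
Proof.
move=> ny nx; rewrite /ts_override (tsKK _ _ ts) (negPf ny).
by rewrite (tsKKr _ _ ts) (negPf nx).
Qed.

Lemma ts_overrideC R (src inj : T -> R) x y :
  ts_override src inj x y = ts_override src inj y x.
Proof.
have [->//|nxy] := eqVneq x y; rewrite /ts_override (tsC ts x).
by have [e|//] := eqVneq (t y x) x; rewrite e (negPf nxy).
Qed.

(** If one side of a triangle is not a leftover edge, neither is the next one, so the override
    respects the whole triangle. *)
Lemma ts_generic_triangle x y : x != y -> y != d x -> x != d y ->
  [/\ x != t x y, t x y != d x & x != d (t x y)].
Proof.
move=> nxy ny nx; split.
- by rewrite eq_sym (tsKK _ _ ts).
- by rewrite -(tsKK _ _ ts) (tsK ts) eq_sym.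
rewrite -(tsKKr _ _ ts) (tsK ts); apply: contra nx => /eqP e.
by rewrite -(tsKKr _ _ ts) -e.
Qed.

(* When the leftover edges form triangles {x, d x, d (d x)}, adding them as
   blocks yields a Steiner triple system. *)
Definition ts_fill (x y : T) : T :=
  if x == y then x else ts_override (fun z => d (d z)) id x y.

Lemma ts_fillP : (forall x, d (d (d x)) = x) -> ts_quasigroup ts_fill.
Proof.
move=> d3; split=> x y.
  by rewrite /ts_fill eq_sym ts_overrideC; case: eqP => // ->.
have F1 u : ts_fill u (d u) = d (d u).
  by rewrite /ts_fill eq_sym (negPf (noid u)) ts_overrideL.
have F2 u : ts_fill (d u) u = d (d u).
  by rewrite /ts_fill (negPf (noid u)) ts_overrideR.
have F3 u v : u != v -> v != d u -> u != d v -> ts_fill u v = t u v.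
  by move=> nuv nvu nuv'; rewrite /ts_fill (negPf nuv) ts_overrideN.
have [->|nxy] := eqVneq x y; first by rewrite /ts_fill !eqxx.
have [->|ny] := eqVneq y (d x); first by rewrite F1 -{1}[x]d3 F2 d3.
have [->|nx] := eqVneq x (d y); first by rewrite F2 F1 d3.
have [nxt ntd nxd] := ts_generic_triangle nxy ny nx.
by rewrite (F3 x y) // F3 ?(tsK ts).
Qed.

(* Here a leftover edge either lies in a triangle {x, d x, d (d x)} or is a pair
   {x, m x}; such a pair is completed to a block by the new point [None]. *)
Section FillOption.

Variable m : T -> T.
Hypothesis mK : involutive m.
Hypothesis m_noncyc : forall x, d (d (d x)) != x -> m x = d x.
Hypothesis m_cyc : forall x, d (d (d x)) = x -> d (d (d (m x))) != m x.

Definition ts_fill_option (p q : option T) : option T :=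
  match p, q with
  | Some x, Some y => if x == y then Some x else
      ts_override (fun z => if d (d (d z)) == z then Some (d (d z)) else None)
        Some x y
  | Some x, None | None, Some x => Some (m x)
  | None, None => None
  end.

Lemma ts_fill_optionP : ts_quasigroup ts_fill_option.
Proof.
split=> [[x|] [y|]|] //.
  by rewrite /= eq_sym ts_overrideC; case: eqP => // ->.
pose src z := if d (d (d z)) == z then Some (d (d z)) else None.
have F1 u : ts_fill_option (Some u) (Some (d u)) = src u.
  by rewrite /= eq_sym (negPf (noid u)) ts_overrideL.
have F2 u : ts_fill_option (Some (d u)) (Some u) = src u.
  by rewrite /= (negPf (noid u)) ts_overrideR.
have F3 u v : u != v -> v != d u -> u != d v ->
    ts_fill_option (Some u) (Some v) = Some (t u v).
  by move=> nuv nvu nuv'; rewrite /= (negPf nuv) ts_overrideN.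
have srcC u : d (d (d u)) = u -> src u = Some (d (d u)).
  by move=> e; rewrite /src e eqxx.
have srcN u : d (d (d u)) != u -> src u = None.
  by move=> /negPf e; rewrite /src e.
move=> [x|] [y|] //; last by rewrite /= mK.
  have [->|nxy] := eqVneq x y; first by rewrite /= !eqxx.
  have [->|ny] := eqVneq y (d x).
    rewrite F1; have [cx|ncx] := eqVneq (d (d (d x))) x.
      by rewrite srcC // -{1}cx F2 srcC !cx.
    by rewrite srcN //= (m_noncyc ncx).
  have [->|nx] := eqVneq x (d y).
    rewrite F2; have [cy|ncy] := eqVneq (d (d (d y))) y.
      by rewrite srcC // F1 srcC ?cy.
    by rewrite srcN //= -(m_noncyc ncy) mK.
  have [nxt ntd nxd] := ts_generic_triangle nxy ny nx.
  by rewrite (F3 x y) // F3 ?(tsK ts).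
change (ts_fill_option (Some x) (Some (m x)) = None).
have [cx|ncx] := eqVneq (d (d (d x))) x; last first.
  by rewrite (m_noncyc ncx) F1 srcN.
(* Now [m x] lies off the leftover triangles and x is [d (m x)], so the value is read from [m x]. *)
have ncm := m_cyc cx; have /esym := m_noncyc ncm; rewrite mK => {1}<-.
by rewrite F2 srcN.
Qed.

End FillOption.

End Override.

(** * The three-level scheme *)

Definition next_level (i : option bool) : option bool :=
  match i with
  | Some false => Some true
  | Some true => None
  | None => Some false
  end.

Lemma next_level3 i : next_level (next_level (next_level i)) = i.
Proof. by case: i => [[]|]. Qed.

Lemma next_level_neq i : next_level i != i.
Proof. by case: i => [[]|]. Qed.

Lemma next_level2_neq i : next_level (next_level i) != i.
Proof. by case: i => [[]|]. Qed.

(* Bose's scheme on three copies of [G] in cyclic order: the third point of two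
   points of a level lies on the next level. *)
Definition level_op (G : finType) (mul div : option bool -> G -> G -> G)
    (p q : G * option bool) : G * option bool :=
  if p.2 == q.2 then (mul p.2 p.1 q.1, next_level p.2)
  else if q.2 == next_level p.2 then (div p.2 p.1 q.1, p.2)
  else (div q.2 q.1 p.1, q.2).

Lemma level_op_ts (G : finType) (mul div : option bool -> G -> G -> G) :
    (forall i, commutative (mul i)) ->
    (forall i x y, mul i x (div i x y) = y) ->
    (forall i x y, div i x (mul i x y) = y) ->
  ts_quasigroup (level_op mul div).
Proof.
move=> mulC mulK divK; split=> -[x i] [y j]; rewrite /level_op /=.
  by case: i j => [[]|] [[]|] //=; rewrite mulC.
have [<-|nij] /= := eqVneq i j.
  by rewrite eq_sym (negPf (next_level_neq i)) eqxx divK.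
have [->|nj] /= := eqVneq j (next_level i); first by rewrite eqxx mulK.
rewrite (negPf nij); have -> : i = next_level j.
  by case: i j nij nj => [[]|] [[]|].
rewrite eq_sym (negPf (next_level2_neq j)).
by rewrite -{2}(mulK j y x) mulC divK.
Qed.

Lemma level_op_diag G mul div p :
  @level_op G mul div p p = (mul p.2 p.1 p.1, next_level p.2).
Proof. by rewrite /level_op eqxx. Qed.

Lemma level_op_noid G mul div p : @level_op G mul div p p != p.
Proof.
rewrite level_op_diag; apply/eqP => /(congr1 snd)/eqP.
by rewrite (negPf (next_level_neq _)).
Qed.

(** * Leftover edges in long cycles *)

Section Cycles.

Variables (T : finType) (t : T -> T -> T) (lvl : T -> option bool).
Hypothesis ts : ts_quasigroup t.
Let d x := t x x.
Hypothesis lvl_d : forall x, lvl (d x) = next_level (lvl x).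
Variable e : T -> T.
Hypotheses (dK : cancel d e) (eK : cancel e d).

Let noid x : d x != x.
Proof.
by apply/eqP => /(congr1 lvl)/eqP; rewrite lvl_d (negPf (next_level_neq _)).
Qed.

(* The pairs {p, d p} form cycles of length divisible by 3, cut into alternating
   single edges (between the first two levels) and cherries centered at the
   third level. *)
Lemma achromatic_cycles : 1 < #|T| -> (forall x, d (d (d x)) != x) ->
  achromatic_number (kneser #|T| 2) = 'C(#|T|.+1, 2) %/ 3.
Proof.
move=> T_gt1 d3.
(* The edge from x to [d x] is centered at its end when x is on the second level and at its start
   when x is on the third: a third-level x centers the path through [e x], x, [d x]. *)
pose src x := match lvl x with
  Some false => None | Some true => Some (d x) | None => Some x end.
pose h := ts_override t src Some.
have hL x : h x (d x) = src x by apply: ts_overrideL.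
have hR x : h (d x) x = src x by apply: ts_overrideR.
have hN x y : y != d x -> x != d y -> h x y = Some (t x y).
  exact: ts_overrideN.
have hC x y : h x y = h y x by apply: ts_overrideC.
have srcE x z : src x = Some z -> z = x \/ z = d x.
  by rewrite /src; case: (lvl x) => [[]|] // [<-]; auto.
have d2 x : d (d x) != x.
  apply/eqP => /(congr1 lvl)/eqP.
  by rewrite !lvl_d (negPf (next_level2_neq _)).
have neT x y : x != y -> y != d x -> x != d y -> t x y != x /\ t x y != y.
  move=> nxy ny nx; split; first by rewrite (tsKK _ _ ts).
  by rewrite (tsKKr _ _ ts).
have single x y : x != y -> h x y = None ->
    y = d x /\ lvl x = Some false \/ x = d y /\ lvl x = Some true.
  move=> nxy; have [->|ny] := eqVneq y (d x).
    by rewrite hL /src; case: (lvl x) => [[]|] // _; left.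
  have [->|nx] := eqVneq x (d y); last by rewrite hN.
  rewrite hR /src lvl_d; case: (lvl y) => [[]|] // _; by right.
have star x y : x != y -> h x y = Some x ->
    lvl x = None /\ (y = d x \/ y = e x).
  move=> nxy; have [->|ny] := eqVneq y (d x).
    rewrite hL /src; case: (lvl x) => [[]|] // => [[/eqP]|_]; last by auto.
    by rewrite (negPf (noid x)).
  have [->|nx] := eqVneq x (d y).
    rewrite hR /src lvl_d dK.
    case: (lvl y) => [[]|] //= => [|[/eqP]]; first by auto.
    by rewrite eq_sym (negPf (noid y)).
  by rewrite hN // => -[/eqP]; rewrite (negPf (neT _ _ nxy ny nx).1).
have lvl_e x : lvl x = None -> lvl (e x) = Some true.
  by move=> lx; have := lvl_d (e x); rewrite eK lx; case: (lvl _) => [[]|].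
apply: (@achromatic_number_kneser _ setT h) => //.
  by rewrite cardsT; lia.
split=> //.
- move=> x y z nxy nzx nzy; have [ey|ny] := eqVneq y (d x).
    rewrite {1}ey hL => /srcE[] ez; first by rewrite ez eqxx in nzx.
    by rewrite ez ey eqxx in nzy.
  have [ex|nx] := eqVneq x (d y).
    rewrite {1}ex hR => /srcE[] ez; first by rewrite ez eqxx in nzy.
    by rewrite ez -ex eqxx in nzx.
  rewrite hN // => -[<-]; have [_ n1 n2] := ts_generic_triangle ts nxy ny nx.
  by rewrite hN // (tsK ts).
- move=> x y z nxy nxz /(single _ _ nxy)[] [ey ly].
    by move=> /(single _ _ nxz)[] [ez lz]; [rewrite ey ez|rewrite ly in lz].
  move=> /(single _ _ nxz)[] [ez lz]; first by rewrite ly in lz.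
  by apply: (can_inj dK); rewrite -ey -ez.
- move=> x y z nxy nxz /(single _ _ nxy) lx /(star _ _ nxz)[lx0 _].
  by case: lx => -[_]; rewrite lx0.
- move=> x y nxy /(star _ _ nxy)[lx ey].
  have hd : h x (d x) = Some x by rewrite hL /src lx.
  have he : h x (e x) = Some x.
    by rewrite -{1}[x]eK hR /src lvl_e // eK.
  have nde : d x != e x.
    by apply: contraNneq (d2 (e x)) => e1; rewrite eK e1.
  (* A single edge between the leaves would force [d (d x) = e x], a cycle of length three, excluded
     by [d3]. *)
  have nh : h (d x) (e x) <> None.
    case/(single _ _ nde) => -[].
      by move/eqP; rewrite -(inj_eq (can_inj dK)) eK eq_sym (negPf (d3 x)).
    by rewrite lvl_d lx.
  have nxe : x != e x by rewrite -{1}[x]eK noid.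
  have nxd : x != d x by rewrite eq_sym noid.
  case: ey => ->.
    exists (e x); split=> // w nxw /(star _ _ nxw)[_]; tauto.
  exists (d x); split=> //; [by rewrite eq_sym|by rewrite hC|].
  move=> w nxw /(star _ _ nxw)[_]; tauto.
move=> x _; case lx: (lvl x) => [[]|].
- exists (e x); first by rewrite -{1}[x]eK noid.
  left; rewrite -{1}[x]eK hR /src.
  by have := lvl_d (e x); rewrite eK lx; case: (lvl _) => [[]|].
- by exists (d x); [rewrite eq_sym|left; rewrite hL /src lx].
by exists (d x); [rewrite eq_sym|right; rewrite hL /src lx].
Qed.

End Cycles.

(** * Leftover triangles with two additional points *)

Section TwoPoints.

Variables (T : finType) (t : T -> T -> T) (lvl : T -> option bool).
Hypothesis ts : ts_quasigroup t.
Let d x := t x x.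
Hypothesis lvl_d : forall x, lvl (d x) = next_level (lvl x).
Hypothesis d3 : forall x, d (d (d x)) = x.
Variable a : T.
Hypothesis lvl_a : lvl a = Some false.

Let noid x : d x != x.
Proof.
by apply/eqP => /(congr1 lvl)/eqP; rewrite lvl_d (negPf (next_level_neq _)).
Qed.

(* For a leftover triangle x, d x, d (d x) with x on the first level: add the
   triangle {w1, x, d x} and the paths w2 - x - d (d x), d (d x) - d x - w2 and
   w1 - d (d x) - w2. One leftover triangle, that of [a], is treated apart,
   since w1 and w2 must be centers as well: its three points and w1, w2 span
   a K_5, cut into five paths. [n1] and [n2] list the two leaves of each center. *)
Lemma achromatic_two_points :
  achromatic_number (kneser #|T|.+2 2) = 'C(#|T|.+3, 2) %/ 3.
Proof.
pose V : finType := option (option T).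
have <- : #|V| = #|T|.+2 by rewrite !card_option.
pose v x : V := Some (Some x).
pose w1 : V := Some None.
pose w2 : V := None.
(* [z] marks the leftover triangle of [a]; [src], [f1] and [f2] place the edges from x to [d x],
   [w1] and [w2]. *)
pose z x := [|| x == a, x == d a | x == d (d a)].
pose src x : V := match lvl x with
  | Some false => if z x then v x else w1
  | Some true => v x
  | None => if z x then v x else v (d x)
  end.
pose f1 x : V := match lvl x with
  | Some false => if z x then w1 else v (d x)
  | Some true => if z x then v x else v (d (d x))
  | None => v x
  end.
pose f2 x : V := match lvl x with
  | Some false => v x
  | _ => if z x then w2 else v x
  end.
pose h (P Q : V) : V := match P, Q with
  | Some (Some x), Some (Some y) => ts_override t src v x y
  | Some (Some x), Some None | Some None, Some (Some x) => f1 x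
  | Some (Some x), None | None, Some (Some x) => f2 x
  | _, _ => w1
  end.
pose n1 (P : V) : V := match P with
  | Some (Some x) => match lvl x with
    | Some false => if z x then v (d x) else v (d (d x))
    | Some true => v (d x)
    | None => if z x then v (d x) else w1
    end
  | Some None => w2
  | None => v (d a)
  end.
pose n2 (P : V) : V := match P with
  | Some (Some x) => match lvl x with
    | Some false => w2
    | _ => if z x then w1 else w2
    end
  | Some None => v a
  | None => v (d (d a))
  end.
have vI : injective v by move=> x y [].
have nv x y : (v x == v y) = (x == y) by apply: inj_eq.
have d_inj : injective d := can_inj (g := fun x => d (d x)) d3.
have d2 x : d (d x) != x.
  by apply: contraNneq (noid x) => e; rewrite -{2}[x]d3 e.
have zd x : z (d x) = z x.
  rewrite /z -{1}[a]d3 !(inj_eq d_inj).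
  by case: (x == a); case: (x == d a); case: (x == d (d a)).
have za : z a by rewrite /z eqxx.
have zP x : z x -> x = match lvl x with
    Some false => a | Some true => d a | None => d (d a) end.
  by case/or3P => /eqP ->; rewrite ?lvl_d lvl_a.
have hL x : h (v x) (v (d x)) = src x by apply: ts_overrideL.
have hR x : h (v (d x)) (v x) = src x by apply: ts_overrideR.
have hN x y : y != d x -> x != d y -> h (v x) (v y) = v (t x y).
  exact: ts_overrideN.
have hC P Q : h P Q = h Q P.
  by case: P Q => [[x|]|] [[y|]|] //; apply: ts_overrideC.
have neT x y : x != y -> y != d x -> x != d y -> t x y != x /\ t x y != y.
  move=> nxy ny nx; split; first by rewrite (tsKK _ _ ts).
  by rewrite (tsKKr _ _ ts).
have ds x : t x x = d x by [].
have star P Q : P != Q -> h P Q = P -> Q = n1 P \/ Q = n2 P.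
  case: P Q => [[x|]|] [[y|]|] //.
  - rewrite -/(v x) -/(v y) nv => nxy; have [->|ny] := eqVneq y (d x).
      rewrite hL /src /n1 /n2 /=; case: (lvl x) => [[]|]; try by auto.
        by case: ifP; auto.
      by case: ifP => _; [auto|move=> /vI/eqP; rewrite (negPf (noid x))].
    have [->|nx] := eqVneq x (d y); last first.
      by rewrite hN // => /vI/eqP; rewrite (negPf (neT _ _ nxy ny nx).1).
    rewrite hR /src /n1 /n2 /= lvl_d zd d3; case: (lvl y) => [[]|] /=.
    + by move/vI/eqP; rewrite eq_sym (negPf (noid y)).
    + by case: ifP => // _ /vI/eqP; rewrite eq_sym (negPf (noid y)).
    by case: ifP => [_ /vI/eqP|]; [rewrite eq_sym (negPf (noid y))|auto].
  - move=> _; rewrite /= /f1 -/(v x); case: (lvl x) => [[]|].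
    + by case: ifP => [|_ /vI/eqP]; [auto|rewrite (negPf (d2 x))].
    + by case: ifP => // _ /vI/eqP; rewrite (negPf (noid x)).
    by case: ifP; auto.
  - move=> _; rewrite /= /f2 -/(v x); case: (lvl x) => [[]|]; try by auto.
      by case: ifP; auto.
    by case: ifP; auto.
  - move=> _ /=; rewrite /f1; case ly: (lvl y) => [[]|]; case zy: (z y) => // _.
    by right; rewrite [y]zP // ly.
  - by left.
  move=> _ /=; rewrite /f2; case ly: (lvl y) => [[]|]; case zy: (z y) => // _.
    by left; rewrite [y]zP // ly.
  by right; rewrite [y]zP // ly.
have n1v x : n1 (v x) = match lvl x with
    | Some false => if z x then v (d x) else v (d (d x))
    | Some true => v (d x)
    | None => if z x then v (d x) else w1
    end by [].
have n2v x : n2 (v x) = match lvl x with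
    | Some false => w2
    | _ => if z x then w1 else w2
    end by [].
have h1E x : h (v x) w1 = f1 x by [].
have h2E x : h (v x) w2 = f2 x by [].
have starE P : [/\ P != n1 P, P != n2 P, n1 P != n2 P, h P (n1 P) = P &
    h P (n2 P) = P].
  case: P => [[x|]|] //; last 2 first.
  - by rewrite /n1 /n2 /= /f1 lvl_a za.
  - rewrite /n1 /n2 /= /f2 !lvl_d lvl_a !zd za nv eq_sym.
    by split=> //; apply: noid.
  rewrite -/(v x) n1v n2v; case lx: (lvl x) => [[]|]; case zx: (z x);
    rewrite ?nv ?[x == d _]eq_sym ?noid ?d2; split=> //;
    rewrite ?hL ?h1E ?h2E ?/src ?/f1 ?/f2 ?lx ?zx //.
  by rewrite -{1}[x]d3 hR /src !lvl_d lx !zd zx d3.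
have tri P Q R : P != Q -> R != P -> R != Q -> h P Q = R -> h P R = Q.
  case: P Q => [[x|]|] [[y|]|] //; rewrite -?/(v x) -?/(v y) -?/w1 -?/w2.
  - rewrite nv => nxy nRx nRy; have [ey|ny] := eqVneq y (d x).
      rewrite {1}ey hL /src; case lx: (lvl x) => [[]|].
      + by move=> e; rewrite -e eqxx in nRx.
      + case: ifP => zx e; rewrite -{}e in nRx nRy *.
          by rewrite eqxx in nRx.
        by rewrite h1E /f1 lx zx ey.
      case: ifP => zx e; rewrite -{}e in nRx nRy *.
        by rewrite eqxx in nRx.
      by rewrite ey eqxx in nRy.
    have [ex|nx] := eqVneq x (d y).
      rewrite {1}ex hR /src; case ly: (lvl y) => [[]|].
      + by move=> e; rewrite -e eqxx in nRy.
      + case: ifP => zy e; rewrite -{}e in nRx nRy *.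
          by rewrite eqxx in nRy.
        by rewrite h1E /f1 ex lvl_d ly zd zy d3.
      case: ifP => zy e; rewrite -{}e in nRx nRy *.
        by rewrite eqxx in nRy.
      by rewrite ex eqxx in nRx.
    rewrite hN // => <-.
    have [_ n1' n2'] := ts_generic_triangle ts nxy ny nx.
    by rewrite hN // (tsK ts).
  - rewrite h1E /f1; case lx: (lvl x) => [[]|]; case zx: (z x) => _ nRx nR1 e;
      rewrite -{}e in nRx nR1 *; rewrite ?eqxx // in nRx nR1 *.
      by rewrite -{1}[x]d3 hR /src !lvl_d lx !zd zx.
    by rewrite hL /src lx zx.
  - rewrite h2E /f2; case lx: (lvl x) => [[]|]; case zx: (z x) => _ nRx nR2 e;
      rewrite -{}e in nRx nR2 *; by rewrite ?eqxx // in nRx nR2 *.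
  - rewrite hC h1E /f1; case ly: (lvl y) => [[]|]; case zy: (z y) =>
      _ nR1 nRy e;
      rewrite -{}e in nR1 nRy *; rewrite ?eqxx // in nR1 nRy *;
      by rewrite hC h1E /f1 ?lvl_d ly ?zd zy ?d3.
  - by move=> _ nR1 _ e; rewrite -e eqxx in nR1.
  - rewrite hC h2E /f2; case ly: (lvl y) => [[]|]; case zy: (z y) =>
      _ nR2 nRy e;
      rewrite -{}e in nR2 nRy *; by rewrite ?eqxx // in nR2 nRy *.
  by move=> _ _ nR1 e; rewrite -e eqxx in nR1.
(* All values are [Some]: there is no single edge, and every vertex is a center. *)
apply: (@achromatic_number_kneser _ setT (fun P Q => Some (h P Q))).
- by rewrite !card_option.
- by rewrite cardsT; lia.
split=> //.
- by move=> P Q; rewrite hC.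
- by move=> P Q R nPQ nRP nRQ [hPQ]; rewrite (tri P Q R).
- move=> P Q nPQ [/(star _ _ nPQ) eQ].
  have [nP1 nP2 n12 h1 h2] := starE P.
  have only W : P != W -> Some (h P W) = Some P -> W = n1 P \/ W = n2 P.
    by move=> nW [/(star _ _ nW)].
  case: eQ => ->; first by exists (n2 P); rewrite h2.
  exists (n1 P); rewrite h1 [n2 P == _]eq_sym n12; split=> // W nW.
  by move/(only _ nW); tauto.
move=> P _; have [nP1 _ _ h1 _] := starE P.
by exists (n1 P); last by right; rewrite h1.
Qed.

End TwoPoints.

Import GRing.Theory.

(** * Bose quasigroups of odd order *)

Section Bose.

Local Open Scope ring_scope.

Variable s : nat.
Let G := 'I_s.*2.+1.
Variable c : G.

(** Halving: [s.+1] inverts 2 modulo [s.*2.+1]. *)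
Let hf (x : G) : G := x *+ s.+1.

Let hfD x : hf x + hf x = x.
Proof.
have e : (s.+1 + s.+1 = s.*2.+1.+1)%N by lia.
rewrite /hf -mulrnDr e mulrS Zp_mulrn.
by apply: val_inj; rewrite /= modnMl addn0 modn_small.
Qed.

Let hfK x y : hf (x + y) = hf x + hf y.
Proof. by rewrite /hf mulrnDl. Qed.

(** Twisting only the third level turns three successive squarings into translation by [c]: leftover
    triangles for zero [c], longer cycles otherwise. *)
Definition bose_shift (i : option bool) : G := if i is None then c else 0.

Definition bose_op := level_op
  (fun i (x y : G) => (x + y) *+ s.+1 + bose_shift i)
  (fun i (x y : G) => (y - bose_shift i) *+ 2 - x).

Lemma bose_ts : ts_quasigroup bose_op.
Proof.
apply: level_op_ts => [i x y|i x y|i x y]; first by rewrite [x + y]addrC.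
  by rewrite [x + _]addrC subrK -[(_ *+ 2) *+ _]/(hf _) mulr2n hfK hfD subrK.
by rewrite addrK mulr2n -[(_ *+ s.+1)]/(hf _) hfD addrC addKr.
Qed.

Lemma bose_diag x i :
  bose_op (x, i) (x, i) = (x + bose_shift i, next_level i).
Proof. by rewrite /bose_op level_op_diag /= -[(_ *+ s.+1)]/(hf _) hfK hfD. Qed.

Definition bose_inv (p : G * option bool) : G * option bool :=
  let i := next_level (next_level p.2) in (p.1 - bose_shift i, i).

Lemma bose_diagK : cancel (fun p => bose_op p p) bose_inv.
Proof. by move=> [x i]; rewrite bose_diag /bose_inv /= next_level3 addrK. Qed.

Lemma bose_invK : cancel bose_inv (fun p => bose_op p p).
Proof. by move=> [x i]; rewrite /bose_inv bose_diag /= next_level3 subrK. Qed.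

Lemma bose_diag3 p (d := fun q => bose_op q q) : d (d (d p)) = (p.1 + c, p.2).
Proof.
rewrite /d; case: p => x i; rewrite !bose_diag next_level3 /=.
by case: i => [[]|] /=; rewrite ?addr0.
Qed.

End Bose.

(** * Skolem quasigroups of even order *)

Section Skolem.

Variable u : nat.
Let G := 'I_u.*2.+2.

(* x + y modulo 2(u+1) composed with a relabelling of the values under which x
   and x + (u+1) both have square x, for x <= u. *)
Definition skolem_out (z : nat) : nat := if odd z then z./2 + u.+1 else z./2.
Definition skolem_in (y : nat) : nat :=
  if (y <= u)%N then y.*2 else (y - u.+1).*2.+1.
(** Arguments stay below twice the modulus, so one subtraction reduces them and the goals remain
    linear. *)
Definition skolem_red (z : nat) : nat :=
  if (z < u.*2.+2)%N then z else z - u.*2.+2.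
Definition skolem_mul (x y : G) : G := inord (skolem_out (skolem_red (x + y))).
Definition skolem_div (x y : G) : G :=
  inord (skolem_red (skolem_in y + (u.*2.+2 - x))).

Lemma skolem_mulE x y :
  skolem_mul x y = skolem_out (skolem_red (x + y)) :> nat.
Proof.
rewrite inordK //; have := ltn_ord x; have := ltn_ord y.
rewrite /skolem_out /skolem_red; do ?case: ifP; lia.
Qed.

Lemma skolem_divE x y :
  skolem_div x y = skolem_red (skolem_in y + (u.*2.+2 - x)) :> nat.
Proof.
rewrite inordK //; have := ltn_ord x; have := ltn_ord y.
rewrite /skolem_in /skolem_red; do ?case: ifP; lia.
Qed.

Definition skolem_op := level_op (fun _ => skolem_mul) (fun _ => skolem_div).

Lemma skolem_ts : ts_quasigroup skolem_op.
Proof.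
apply: level_op_ts => [_ x y|_ x y|_ x y]; apply: ord_inj.
- by rewrite !skolem_mulE addnC.
- rewrite skolem_mulE skolem_divE; have := ltn_ord x; have := ltn_ord y.
  rewrite /skolem_out /skolem_red /skolem_in; do ?case: ifP; lia.
rewrite skolem_divE skolem_mulE; have := ltn_ord x; have := ltn_ord y.
rewrite /skolem_out /skolem_red /skolem_in; do ?case: ifP; lia.
Qed.

Lemma skolem_diag (x : G) :
  skolem_mul x x = (if (x <= u)%N then x : nat else x - u.+1)%N :> nat.
Proof.
rewrite skolem_mulE; have := ltn_ord x.
rewrite /skolem_out /skolem_red; do ?case: ifP; lia.
Qed.

(** A lower-half point, which lies on a leftover triangle, goes to the upper-half point whose square
    it is; an upper-half point goes to its square. *)
Definition skolem_match (p : G * option bool) : G * option bool :=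
  if (p.1 <= u)%N then (inord (p.1 + u.+1), next_level (next_level p.2))
  else (inord (p.1 - u.+1), next_level p.2).

Lemma skolem_matchK : involutive skolem_match.
Proof.
move=> [x i]; rewrite {2}/skolem_match /=; have xN := ltn_ord x.
case: leqP => xu; rewrite /skolem_match /= inordK; try by lia.
  have -> : (x + u.+1 <= u) = false by lia.
  by rewrite addnK inord_val next_level3.
have -> : x - u.+1 <= u by lia.
by rewrite subnK // inord_val next_level3.
Qed.

(** The first squaring lands in the lower half, where [skolem_mul] is idempotent. *)
Lemma skolem_diag3 p (d := fun q => skolem_op q q) :
  d (d (d p)) = (skolem_mul p.1 p.1, p.2).
Proof.
rewrite /d; case: p => x i; rewrite /skolem_op !level_op_diag /= next_level3.
congr pair.
apply: ord_inj; rewrite !skolem_diag; have : (x < u.*2.+2) := ltn_ord x.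
do ?case: ifP; lia.
Qed.

Lemma skolem_fix p (d := fun q => skolem_op q q) :
  (d (d (d p)) == p) = (p.1 <= u)%N.
Proof.
rewrite /d skolem_diag3; case: p => x i /=; rewrite xpair_eqE eqxx andbT.
rewrite -val_eqE /= skolem_diag; have : (x < u.*2.+2) := ltn_ord x.
do ?case: ifP; lia.
Qed.

Lemma skolem_match_fix p : ((skolem_match p).1 <= u) = ~~ (p.1 <= u).
Proof.
case: p => x i; rewrite /skolem_match /=; have := ltn_ord x.
case: (leqP x u) => /= pu pN.
  rewrite inordK; lia.
rewrite inordK; lia.
Qed.

Lemma skolem_match_noncyc (p : G * option bool) :
  ~~ (p.1 <= u) -> skolem_match p = skolem_op p p.
Proof.
case: p => x i /= /negPf pu.
rewrite /skolem_match /skolem_op level_op_diag /= pu.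
congr pair; apply: ord_inj; rewrite skolem_diag pu inordK //.
have := ltn_ord x; do ?case: ifP; lia.
Qed.

End Skolem.

(** * The residue classes of n *)

Lemma card_levels n : #|{: 'I_n * option bool}| = (n * 3)%N.
Proof. by rewrite card_prod card_ord card_option card_bool. Qed.

(** The leftover edges may have any shape here, so addition in a cyclic group of either parity
    serves. *)
Lemma achromatic_mod3_1 q :
  achromatic_number (kneser (q.+1 * 3).+1 2) = 'C((q.+1 * 3).+2, 2) %/ 3.
Proof.
pose t := level_op (fun _ (x y : 'I_q.+1) => x + y)%R (fun _ x y => y - x)%R.
rewrite -card_levels; apply: (@achromatic_ts_option _ t).
- apply: level_op_ts => [_ x y|_ x y|_ x y]; first exact: addrC.
    by rewrite addrC subrK.
  by rewrite addrC addKr.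
- exact: level_op_noid.
by rewrite card_levels.
Qed.

Lemma achromatic_mod6_3 s : (0 < s)%N ->
  achromatic_number (kneser (s.*2.+1 * 3) 2) = 'C((s.*2.+1 * 3).+1, 2) %/ 3.
Proof.
(* A nonzero shift prevents leftover triangles; it exists because s is positive, s = 0 being the
   exceptional n = 3. *)
move=> s_gt0; pose c : 'I_s.*2.+1 := ord_max.
have nc : c != 0%R by rewrite -val_eqE /=; lia.
rewrite -card_levels.
apply: (@achromatic_cycles _ (bose_op c) snd (bose_ts c) _ (bose_inv c)).
- by move=> [x i]; rewrite bose_diag.
- exact: bose_diagK.
- exact: bose_invK.
- by rewrite card_levels; lia.
move=> [x i]; rewrite bose_diag3 xpair_eqE /= eqxx andbT.
by rewrite -subr_eq0 addrC addKr.
Qed.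

Lemma achromatic_mod6_5 s :
  achromatic_number (kneser (s.*2.+1 * 3).+2 2) = 'C((s.*2.+1 * 3).+3, 2) %/ 3.
Proof.
rewrite -card_levels; pose c : 'I_s.*2.+1 := 0%R.
apply: (@achromatic_two_points _ (bose_op c) snd (bose_ts c) _ _
  (c, Some false)).
- by move=> [x i]; rewrite bose_diag.
- by move=> [x i]; rewrite bose_diag3 addr0.
by [].
Qed.

Lemma achromatic_mod6_2 s :
  achromatic_number (kneser (s.*2.+1 * 3).-1 2) = 'C(s.*2.+1 * 3, 2) %/ 3.
Proof.
rewrite -card_levels; pose c : 'I_s.*2.+1 := 0%R.
apply: (@achromatic_ts_point _ (ts_fill (bose_op c)) (c, None)).
- apply: ts_fillP; first exact: bose_ts.
    by move=> p; apply: level_op_noid.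
  by move=> [x i]; rewrite bose_diag3 addr0.
- by move=> x; rewrite /ts_fill eqxx.
by rewrite card_levels; lia.
Qed.

Lemma achromatic_mod6_0 u :
  achromatic_number (kneser (u.*2.+2 * 3) 2) = 'C((u.*2.+2 * 3).+1, 2) %/ 3.
Proof.
have := @achromatic_ts_point _
  (ts_fill_option (@skolem_op u) (@skolem_match u)) None.
rewrite card_option card_levels; apply=> //.
- apply: ts_fill_optionP.
  + exact: skolem_ts.
  + by move=> p; apply: level_op_noid.
  + exact: skolem_matchK.
  + by move=> p; rewrite skolem_fix => /skolem_match_noncyc.
  by move=> p /eqP; rewrite !skolem_fix skolem_match_fix negbK.
by move=> [x|] //=; rewrite eqxx.
Qed.

Theorem theorem3p1 :
  (forall n : nat, 2 <= n -> n <> 3 ->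
     achromatic_number (kneser n 2) = 'C(n.+1, 2) %/ 3) /\
  achromatic_number (kneser 3 2) = 1.
Proof.
split=> [n n2 n3|].
  case r3: (n %% 3) (ltn_pmod n (isT : 0 < 3)) => [|[|[|]]] // _.
  - have [s [[s_gt0 ->]|->]] :
        exists s, (0 < s /\ n = s.*2.+1 * 3) \/ n = s.*2.+2 * 3.
      (* The quotient is 2s+1 or 2s+2, and the same formula recovers s; excluding n = 3 makes s
         positive in the odd case. *)
      by exists (n %/ 3).-1./2; lia.
    + exact: achromatic_mod6_3.
    exact: achromatic_mod6_0.
  - have -> : n = ((n %/ 3).-1.+1 * 3).+1 by lia.
    exact: achromatic_mod3_1.
  have [s [->|en]] : exists s, n = (s.*2.+1 * 3).+2 \/ n = (s.*2.+1 * 3).-1.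
    have [odd_q|even_q] := boolP (odd (n %/ 3)).
      by exists (n %/ 3)./2; left; lia.
    by exists (n %/ 3)./2; right; lia.
  - exact: achromatic_mod6_5.
  by have := achromatic_mod6_2 s; have -> : s.*2.+1 * 3 = n.+1 by lia.
(* Disjoint pairs would need four points, so the graph is edgeless and a complete coloring has at
   most one color. *)
have kn3 A B : kneser 3 2 A B = false.
  apply/negP => /disjoint_setI0 AB0.
  have := max_card (mem (val A :|: val B)).
  by rewrite cardsU AB0 cards0 (eqP (valP A)) (eqP (valP B)) card_ord.
have has1 : has_proper_complete_coloring (kneser 3 2) 1.
  apply/existsP; exists [ffun=> ord0]; apply/and3P; split.
  - apply/forallP => i.
    have /card_gt0P[A _] : 0 < #|{: kneser_vertex 3 2}|.
      by rewrite card_kneser_vertex.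
    by apply/existsP; exists A; rewrite (ord1 i) ord1.
  - by apply/forallP => A; apply/forallP => B; rewrite kn3.
  by apply/forallP => i; apply/forallP => j; rewrite !ord1.
have := leq_achromatic_number has1; have := achromatic_number_attained has1.
case: (achromatic_number _) => [|[|l]] // /existsP[c /and3P[_ _]].
move=> /forallP/(_ ord0)/forallP/(_ ord_max) /existsP[A /existsP[B]].
by rewrite kn3.
Qed.
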